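(* Let $(E,\rho,[\cdot,\cdot]_E,L)$ be a regular local pre-Leibniz algebroid over $M$ with a locality projector $\mathcal{P}$. If $(g,\nabla)$ is an $E$-Hessian structure, then $g$ is $\nabla$-Codazzi, i.e. the $E$-non-metricity tensor $Q(\nabla,g)=\nabla g$ is totally symmetric.
   Context: Everything is smooth; $M$ is an orientable, paracompact, Hausdorff smooth manifold, $E\to M$ a real vector bundle, $\mathfrak{X}(E)=\Gamma(E)$, $\Omega^1(E)=\Gamma(E^* )$. An anchored vector bundle $(E,\rho)$ is a vector bundle $E$ with a vector bundle morphism $\rho:E\to T(M)$ over the identity; it is regular if $\rho$ has locally constant rank. A linear $E$-connection is an $\mathbb{R}$-bilinear map $\nabla:\mathfrak{X}(E)\times\mathfrak{X}(E)\to\mathfrak{X}(E)$ with $\nabla_u(fv)=\rho(u)(f)v+f\nabla_u v$ and $\nabla_{fu}v=f\nabla_u v$. An $E$-metric is a symmetric non-degenerate section $g$ of $E^*\otimes E^*$; the $E$-non-metricity is $Q(\nabla,g)(u,v,w)=(\nabla g)(u,v,w)=\rho(u)(g(v,w))-g(\nabla_u v,w)-g(v,\nabla_u w)$. A local almost-Leibniz algebroid $(E,\rho,[\cdot,\cdot]_E,L)$ is an anchored vector bundle with an $\mathbb{R}$-bilinear bracket $[\cdot,\cdot]_E$ on $\mathfrak{X}(E)$ and a $C^\infty(M,\mathbb{R})$-multilinear map $L:\Omega^1(E)\times\mathfrak{X}(E)\times\mathfrak{X}(E)\to\mathfrak{X}(E)$ with $[u,fv]_E=\rho(u)(f)v+f[u,v]_E$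 and $[fu,v]_E=-\rho(v)(f)u+f[u,v]_E+L(Df,u,v)$, where $(Df)(u):=\rho(u)(f)$. It is a local pre-Leibniz algebroid if moreover $\rho([u,v]_E)=[\rho(u),\rho(v)]$. A locality projector is a $C^\infty(M,\mathbb{R})$-linear map $\mathcal{P}:\mathfrak{X}(E)\to\mathfrak{X}(E)$ such that the image of $\widehat{L}:=\mathcal{P}L$ lies in the kernel of $\rho$, and $\mathcal{P}$ restricted to the kernel of $\rho$ is the identity. The projected modified bracket is $[u,v]_E^{\widehat{\nabla}}:=[u,v]_E-\widehat{L}(e^a,\nabla_{X_a}u,v)$ (sum over $a$; $(X_a)$ any local frame of $E$ with dual coframe $(e^a)$). The projected $E$-torsion operator is $\widehat{T}(\nabla)(u,v):=\nabla_u v-\nabla_v u-[u,v]_E^{\widehat{\nabla}}$; $\nabla$ is projected $E$-torsion-free if $\widehat{T}(\nabla)=0$. The $E$-curvature is $R(\nabla)(u,v)w:=\nabla_u\nabla_v w-\nabla_v\nabla_u w-\nabla_{[u,v]_E^{\widehat{\nabla}}}w$; $\nabla$ is $E$-flat if $R(\nabla)=0$. The $E$-Hessian of a function $f$ is $H(\nabla)(f)(u,v):=\rho(u)(\rho(v)(f))-Df(\nabla_u v)$. An $E$-Hessian structure is a pair $(g,\nabla)$ where $\nabla$ is an $E$-flat, projected $E$-torsion-free linear $E$-connection and $g$ is an $E$-metric that is locally (in a neighbourhood of each point) of the form $g=H(\nabla)(f)$ for some smooth function $f$. *)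

(* Defs.v *)
From HB Require Import structures.
From mathcomp Require Import all_boot all_order all_algebra.
From mathcomp Require Import all_classical all_reals all_analysis.
Set Implicit Arguments.
Unset Strict Implicit.
Unset Printing Implicit Defensive.
Import Order.TTheory GRing.Theory Num.Theory numFieldNormedType.Exports.
Local Open Scope classical_set_scope.
Local Open Scope ring_scope.

Section Ck.
Variables (R : realType) (V W : normedModType R).

(* To be used with [U] open and [V] finite-dimensional, where "all directional
   derivatives are C^k" is the same as "the differential is C^k". *)
Fixpoint Ck (k : nat) (U : set V) (f : V -> W) : Prop :=
  if k is k'.+1 then
    (forall x, U x -> differentiable f x) /\
    (forall v, Ck k' U (fun x => 'D_v f x))
  else forall x, U x -> {for x, continuous f}.

Definition Csmooth (U : set V) (f : V -> W) := forall k, Ck k U f.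

Lemma near_eq_differentiable (f g : V -> W) (x : V) :
  (\forall y \near x, f y = g y) -> differentiable f x -> differentiable g x.
Proof.
move=> fg /diff_locallyP [dfc dfE].
have h : g \o shift x = cst (g x) + 'd f x +o_ 0 id.
  apply/eqaddoP => _/posnumP[e].
  move: dfE => /eqaddoP/(_ _ [gt0 of e%:num]) dfE.
  have fg0 : \forall z \near (0 : V), f (shift x z) = g (shift x z).
    have : shift x @ (0:V) --> x.
      rewrite -[X in _ --> X]add0r.
      by apply: (@cvgD _ _ _ _ _ id (cst x)); [exact: cvg_id|exact: cvg_cst].
    by move=> /(_ _ fg).
  near=> z.
  have -> : (g \o shift x - (cst (g x) + 'd f x)) z =
            (f \o shift x - (cst (f x) + 'd f x)) z.
    have E1 : g (z + x) = f (z + x) by apply/esym; near: z.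
    have E2 : g x = f x by apply/esym; exact: (nbhs_singleton fg).
    by rewrite ![_ z]/= !fctE /= E1 E2.
  by near: z.
by apply/diff_locallyP; rewrite (diff_unique dfc h).
Unshelve. all: by end_near. Qed.

Lemma Ck_sub k (U U' : set V) (f : V -> W) : U' `<=` U -> Ck k U f -> Ck k U' f.
Proof.
move=> UU; elim: k f => [|k IH] f /=; first by move=> h x /UU /h.
by case=> h1 h2; split=> [x /UU /h1 //|v]; exact: IH.
Qed.

Lemma Ck_local k (U : set V) (f : V -> W) :
  (forall x, U x -> exists U', U' x /\ Ck k U' f) -> Ck k U f.
Proof.
elim: k f => [|k IH] f /= h; first by move=> x /h[U' [U'x]]; exact.
split=> [x /h [U' [U'x []]]|v]; first by move=> + _; exact.
by apply: IH => x /h [U' [U'x [_ h2]]]; exists U'.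
Qed.

Lemma Ck_ext k (U : set V) (f g : V -> W) : open U ->
  (forall x, U x -> f x = g x) -> Ck k U f -> Ck k U g.
Proof.
move=> oU; have near_U x : U x -> forall P : V -> Prop, (forall y, U y -> P y) ->
    \forall y \near x, P y.
  by move=> Ux P UP; apply: filterS UP _; exact: open_nbhs_nbhs.
elim: k f g => [|k IH] f g fg /=.
  move=> h x Ux; have fgx := near_U x Ux _ fg.
  rewrite /prop_for /continuous_at -(fg _ Ux).
  by apply: cvg_trans (h x Ux); exact: near_eq_cvg.
case=> h1 h2; split=> [x Ux|v].
  exact: near_eq_differentiable (near_U x Ux _ fg) (h1 _ Ux).
by apply: IH (h2 v) => x Ux; apply: near_eq_derive; exact: near_U.
Qed.

Lemma CkW k (U : set V) (f : V -> W) : Ck k.+1 U f -> Ck k U f.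
Proof.
elim: k f => [|k IH] f.
  by case=> h _ x Ux; apply: differentiable_continuous; exact: h.
by case=> h1 h2; split=> // v; exact: IH.
Qed.

Lemma Ck_cst k (U : set V) (a : W) : Ck k U (fun=> a).
Proof.
elim: k a => [|k IH] a /=; first by move=> x _; exact: cvg_cst.
split=> [x _|v]; first exact: differentiable_cst.
suff -> : (fun x => 'D_v (fun=> a : W) x) = (fun=> 0) by exact: IH.
by apply/funext => x; exact: derive_cst.
Qed.

Lemma CkD k (U : set V) (f g : V -> W) : open U ->
  Ck k U f -> Ck k U g -> Ck k U (fun x => f x + g x).
Proof.
move=> oU; elim: k f g => [|k IH] f g /=.
  by move=> hf hg x Ux; apply: cvgD; [exact: hf|exact: hg].
move=> [f1 f2] [g1 g2]; split=> [x Ux|v].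
  by apply: differentiableD; [exact: f1|exact: g1].
apply: (Ck_ext oU _ (IH _ _ (f2 v) (g2 v))) => x Ux.
by rewrite -deriveD //; apply: diff_derivable; [exact: f1|exact: g1].
Qed.

End Ck.

Section CkM.
Variables (R : realType) (V : normedModType R).

Lemma CkM k (U : set V) (f g : V -> R) : open U ->
  Ck k U f -> Ck k U g -> Ck k U (fun x => f x * g x).
Proof.
move=> oU; elim: k f g => [|k IH] f g.
  by move=> hf hg x Ux; apply: cvgM; [exact: hf|exact: hg].
move=> hf hg; have [f1 f2] := hf; have [g1 g2] := hg; split=> [x Ux|v].
  by apply: differentiableM; [exact: f1|exact: g1].
apply: (Ck_ext oU _ (CkD oU (IH _ _ (CkW hf) (g2 v)) (IH _ _ (CkW hg) (f2 v)))).
by move=> x Ux; rewrite -deriveM //; apply: diff_derivable; [exact: f1|exact: g1].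
Qed.

End CkM.

Record chart (R : realType) (n : nat) (M : topologicalType) := Chart {
  cdom : set M ;
  cmap : M -> 'rV[R]_n ;
  cinv : 'rV[R]_n -> M ;
  cdom_open : open cdom ;
  crange_open : open (cmap @` cdom) ;
  cmapK : forall x, cdom x -> cinv (cmap x) = x ;
  cmap_continuous : forall x, cdom x -> {for x, continuous cmap} ;
  cinv_continuous : forall y, (cmap @` cdom) y -> {for y, continuous cinv} }.

Definition compatible_charts (R : realType) (n : nat) (M : topologicalType)
    (c d : chart R n M) :=
  Csmooth (cmap c @` (cdom c `&` cdom d)) (cmap d \o cinv c) /\
  Csmooth (cmap d @` (cdom c `&` cdom d)) (cmap c \o cinv d).

Record manifold (R : realType) (n : nat) := Manifold {
  mcarrier :> topologicalType ;
  atlas : set (chart R n mcarrier) ;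
  atlas_cover : forall x, exists2 c, atlas c & cdom c x ;
  atlas_compatible : forall c d, atlas c -> atlas d -> compatible_charts c d ;
  atlas_maximal : forall c, (forall d, atlas d -> compatible_charts c d) -> atlas c }.

Arguments atlas {R n} m.

Definition paracompact (T : topologicalType) :=
  forall C : set (set T), C `<=` open -> \bigcup_(A in C) A = setT ->
  exists D : set (set T),
    [/\ D `<=` open, \bigcup_(B in D) B = setT,
        forall B, D B -> exists2 A, C A & B `<=` A &
        forall x : T, exists2 N, nbhs x N &
          finite_set [set B | D B /\ B `&` N !=set0]].

Definition orientable (R : realType) (n : nat) (M : manifold R n) :=
  exists A : set (chart R n M),
    [/\ A `<=` atlas M, forall x : M, exists2 c, A c & cdom c x &
        forall c d, A c -> A d -> forall x, cdom c x -> cdom d x ->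
          0 < \det (jacobian (cmap d \o cinv c) (cmap c x))].

Section SmoothFunctions.
Variables (R : realType) (n : nat) (M : manifold R n).
Implicit Types (U : set M) (f g : M -> R).

(* Smoothness, on the open set [U], of the restriction of [f] to [U]. *)
Definition smooth_on U f :=
  forall c, atlas M c -> Csmooth (cmap c @` (U `&` cdom c)) (f \o cinv c).

Definition smooth_near (x : M) f :=
  exists U, [/\ open U, U x & smooth_on U f].

Lemma chart_image_open (c : chart R n M) U : open U ->
  open (cmap c @` (U `&` cdom c)).
Proof.
move=> oU; rewrite openE => _ [x [Ux cx] <-].
have cxr : (cmap c @` cdom c) (cmap c x) by exists x.
have h1 : \forall y \near cmap c x, (cmap c @` cdom c) y.
  by apply: open_nbhs_nbhs; split => //; exact: crange_open.
have h2 : \forall y \near cmap c x, U (cinv c y).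
  apply: (cinv_continuous cxr); rewrite cmapK //.
  exact: open_nbhs_nbhs.
by apply: filterS2 h1 h2 => _ [z cz <-]; rewrite cmapK // => Uz; exists z.
Qed.

Lemma smooth_on_sub U U' f : U' `<=` U -> smooth_on U f -> smooth_on U' f.
Proof.
move=> UU h c hc k; apply: Ck_sub (h c hc k).
by move=> _ [x [/UU Ux cx] <-]; exists x.
Qed.

Lemma smooth_on_local U f :
  (forall x, U x -> exists U', U' x /\ smooth_on U' f) -> smooth_on U f.
Proof.
move=> h c hc k; apply: Ck_local => _ [x [/h [U' [U'x sf]] cx] <-].
by exists (cmap c @` (U' `&` cdom c)); split; [exists x|exact: sf].
Qed.

Lemma smooth_on_ext U f g : open U -> (forall x, U x -> f x = g x) ->
  smooth_on U f -> smooth_on U g.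
Proof.
move=> oU fg h c hc k; apply: Ck_ext (h c hc k); first exact: chart_image_open.
by move=> _ [x [Ux cx] <-] /=; rewrite cmapK ?fg.
Qed.

Lemma smooth_on_cst U (a : R) : smooth_on U (fun=> a).
Proof. by move=> c hc k; exact: Ck_cst. Qed.

Lemma smooth_onD U f g : open U -> smooth_on U f -> smooth_on U g ->
  smooth_on U (fun x => f x + g x).
Proof.
move=> oU hf hg c hc k.
exact: (CkD (chart_image_open oU) (hf c hc k) (hg c hc k)).
Qed.

Lemma smooth_onM U f g : open U -> smooth_on U f -> smooth_on U g ->
  smooth_on U (fun x => f x * g x).
Proof.
move=> oU hf hg c hc k.
exact: (CkM (chart_image_open oU) (hf c hc k) (hg c hc k)).
Qed.

Lemma smooth_onN U f : open U -> smooth_on U f -> smooth_on U (fun x => - f x).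
Proof.
move=> oU hf; have := smooth_onM oU (smooth_on_cst U (-1)) hf.
by apply: smooth_on_ext => // x _; rewrite mulN1r.
Qed.

Lemma smooth_on_sum U (I : Type) (r : seq I) (F : I -> M -> R) : open U ->
  (forall i, smooth_on U (F i)) -> smooth_on U (fun x => \sum_(i <- r) F i x).
Proof.
move=> oU hF; elim: r => [|i r IH].
  apply: smooth_on_ext (smooth_on_cst U 0) => // x _.
  by rewrite big_nil.
apply: smooth_on_ext (smooth_onD oU (hF i) IH) => // x _.
by rewrite big_cons.
Qed.

Definition smooth_pred : {pred (M -> R)} := [pred f | `[< smooth_on setT f >]].

Lemma smooth_pred_subring : subring_closed smooth_pred.
Proof.
split=> [|f g /asboolP hf /asboolP hg|f g /asboolP hf /asboolP hg]; apply/asboolP.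
- exact: smooth_on_cst.
- exact: (smooth_onD openT hf (smooth_onN openT hg)).
- exact: (smooth_onM openT hf hg).
Qed.

Record smooth_fun := SmoothFun { sf_val :> M -> R ; sf_smooth : sf_val \in smooth_pred }.

HB.instance Definition _ := [isSub for sf_val].
HB.instance Definition _ := [Choice of smooth_fun by <:].
HB.instance Definition _ := GRing.SubChoice_isSubComPzRing.Build
  (M -> R) smooth_pred smooth_fun smooth_pred_subring.

Lemma smooth_funP (f : smooth_fun) : smooth_on setT f.
Proof. by case: f => f /= /asboolP. Qed.

Definition mk_smooth_fun (f : M -> R) (hf : smooth_on setT f) : smooth_fun :=
  SmoothFun (asboolT hf : f \in smooth_pred).

Definition cst_fun (a : R) : smooth_fun := mk_smooth_fun (smooth_on_cst setT a).

End SmoothFunctions.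

Section Tangent.
Variables (R : realType) (n : nat) (M : manifold R n) (x : M).

(* Derivations at [x] of the algebra of germs at [x] of smooth functions.  A germ
   is represented by a function on [M] which is smooth near [x]; the value at the
   remaining functions is normalized to 0, so that equality is equality of
   derivations. *)
Definition derivation_at (v : (M -> R) -> R^o) :=
  [/\ forall f, ~ smooth_near x f -> v f = 0,
      forall f g, (\forall y \near x, f y = g y) -> v f = v g,
      forall (a : R) f g, smooth_near x f -> smooth_near x g ->
        v (fun y => a * f y + g y) = a * v f + v g &
      forall f g, smooth_near x f -> smooth_near x g ->
        v (fun y => f y * g y) = v f * g x + f x * v g].

Definition derivation_pred : {pred ((M -> R) -> R^o)} :=
  [pred v | `[< derivation_at v >]].

Lemma derivation_submod : submod_closed derivation_pred.
Proof.
split; first by apply/asboolP; split=> *; rewrite /= ?(mulr0, mul0r, addr0).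
move=> a u v /asboolP[u0 u1 u2 u3] /asboolP[v0 v1 v2 v3]; apply/asboolP.
split=> [f sf|f g fg|b f g sf sg|f g sf sg]; rewrite !fctE /=.
- by rewrite u0 // v0 // addr0 scaler0.
- by rewrite (u1 _ _ fg) (v1 _ _ fg).
- rewrite u2 // v2 // /GRing.scale /=.
  by rewrite !mulrDr addrACA mulrCA.
- rewrite u3 // v3 // /GRing.scale /=.
  by rewrite !(mulrDr, mulrDl) mulrA [a * (f x * _)]mulrCA addrACA.
Qed.

HB.instance Definition _ :=
  GRing.isSubmodClosed.Build R ((M -> R) -> R^o) derivation_pred derivation_submod.

Record tangent := Tangent {
  tangent_val :> (M -> R) -> R^o ;
  tangent_derivation : tangent_val \in derivation_pred }.

HB.instance Definition _ := [isSub for tangent_val].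
HB.instance Definition _ := [Choice of tangent by <:].
HB.instance Definition _ := [SubChoice_isSubLmodule of tangent by <:].

End Tangent.
Arguments tangent {R n M} x.

Section Dual.
Variables (R : realType) (V : lmodType R).

Definition linear_pred : {pred (V -> R^o)} := [pred w | `[< linear w >]].

Lemma linear_pred_submod : submod_closed linear_pred.
Proof.
split; first by apply/asboolP => a u v; rewrite /= scaler0 addr0.
move=> a f g /asboolP lf /asboolP lg; apply/asboolP => b u v.
by rewrite !fctE lf lg !scalerDr addrACA !scalerA mulrC.
Qed.

HB.instance Definition _ :=
  GRing.isSubmodClosed.Build R (V -> R^o) linear_pred linear_pred_submod.

Record dual := Dual { dual_val :> V -> R^o ; dual_linear : dual_val \in linear_pred }.

HB.instance Definition _ := [isSub for dual_val].
HB.instance Definition _ := [Choice of dual by <:].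
HB.instance Definition _ := [SubChoice_isSubLmodule of dual by <:].

Definition mk_dual (w : V -> R^o) (hw : linear w) : dual :=
  Dual (asboolT hw : w \in linear_pred).

Lemma dualP (w : dual) : linear w.
Proof. by case: w => w /= /asboolP. Qed.

End Dual.

Section Bundle.
Variables (R : realType) (n : nat) (M : manifold R n).

(* [tcoord] and [tinv] are only meaningful over the open set [tdom]. *)
Record trivialization (E : M -> lmodType R) := Trivialization {
  tdom : set M ;
  trank : nat ;
  tcoord : forall x, {linear E x -> 'rV[R]_trank} ;
  tinv : forall x, 'rV[R]_trank -> E x ;
  tdom_open : open tdom ;
  tcoordK : forall x, tdom x -> cancel (tcoord x) (tinv x) ;
  tinvK : forall x, tdom x -> cancel (tinv x) (tcoord x) }.

Arguments tcoord {E} t x.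
Arguments tinv {E} t x _.

Definition tframe (E : M -> lmodType R) (t : trivialization E)
  (a : 'I_(trank t)) (x : M) : E x := tinv t x (delta_mx 0 a).

Arguments tframe {E} t a x.

(* The entries of the transition functions are smooth.  The rank is only
   required to be locally constant. *)
Record vbundle := VBundle {
  fibre :> M -> lmodType R ;
  btriv : set (trivialization fibre) ;
  btriv_cover : forall x, exists2 t, btriv t & tdom t x ;
  btriv_smooth : forall s t, btriv s -> btriv t -> forall a b,
    smooth_on (tdom s `&` tdom t) (fun x => tcoord t x (tframe s a x) 0 b) }.

Arguments btriv v : clear implicits.

Lemma tframe_expand (E : M -> lmodType R) (t : trivialization E) x (e : E x) :
  tdom t x -> e = \sum_a tcoord t x e 0 a *: tframe t a x.
Proof.
move=> tx; apply: (can_inj (tcoordK tx)).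
rewrite linear_sum /= [LHS]row_sum_delta; apply: eq_bigr => a _.
by rewrite linearZ /= tinvK.
Qed.

Definition smooth_section (E : vbundle) (s : forall x, E x) :=
  forall t, btriv E t -> forall a,
    smooth_on (tdom t) (fun x => tcoord t x (s x) 0 a).

Record section (E : vbundle) := Section_ {
  sec_val :> forall x, E x ;
  sec_smooth : smooth_section sec_val }.

Lemma sectionP (E : vbundle) (u v : section E) : (forall x, u x = v x) -> u = v.
Proof.
case: u v => u hu [v hv] /= uv.
have {}uv : u = v by apply: functional_extensionality_dep.
by subst v; congr Section_; exact: Prop_irrelevance.
Qed.

HB.instance Definition _ (E : vbundle) := gen_eqMixin (section E).
HB.instance Definition _ (E : vbundle) := gen_choiceMixin (section E).

Section Operations.
Variable E : vbundle.

Lemma sec0_subproof : smooth_section (fun x => 0 : E x).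
Proof.
move=> t ht a; apply: smooth_on_ext (smooth_on_cst _ 0); first exact: tdom_open.
by move=> x _; rewrite linear0 mxE.
Qed.

Lemma secD_subproof (u v : section E) : smooth_section (fun x => u x + v x).
Proof.
move=> t ht a; have ot := tdom_open t.
apply: smooth_on_ext (smooth_onD ot (sec_smooth u ht a) (sec_smooth v ht a)) => //.
by move=> x _; rewrite linearD mxE.
Qed.

Lemma secZ_subproof (f : smooth_fun M) (u : section E) :
  smooth_section (fun x => f x *: u x).
Proof.
move=> t ht a; have ot := tdom_open t.
have sf : smooth_on (tdom t) f by apply: smooth_on_sub (smooth_funP f).
apply: smooth_on_ext (smooth_onM ot sf (sec_smooth u ht a)) => //.
by move=> x _; rewrite linearZ mxE.
Qed.

Lemma secN_subproof (u : section E) : smooth_section (fun x => - u x).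
Proof.
move=> t ht a; have ot := tdom_open t.
apply: smooth_on_ext (smooth_onN ot (sec_smooth u ht a)) => //.
by move=> x _; rewrite linearN mxE.
Qed.

Definition sec0 : section E := Section_ sec0_subproof.
Definition secD u v : section E := Section_ (secD_subproof u v).
Definition secN u : section E := Section_ (secN_subproof u).
Definition secZ f u : section E := Section_ (secZ_subproof f u).

Fact secDA : associative secD.
Proof. by move=> u v w; apply: sectionP => x; exact: addrA. Qed.
Fact secDC : commutative secD.
Proof. by move=> u v; apply: sectionP => x; exact: addrC. Qed.
Fact sec0D : left_id sec0 secD.
Proof. by move=> u; apply: sectionP => x; exact: add0r. Qed.
Fact secND : left_inverse sec0 secN secD.
Proof. by move=> u; apply: sectionP => x; exact: addNr. Qed.

HB.instance Definition _ :=
  GRing.isZmodule.Build (section E) secDA secDC sec0D secND.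

Fact secZA f g u : secZ f (secZ g u) = secZ (f * g) u.
Proof. by apply: sectionP => x; exact: scalerA. Qed.
Fact sec1Z : left_id 1 secZ.
Proof. by move=> u; apply: sectionP => x; exact: scale1r. Qed.
Fact secZDr : right_distributive secZ +%R.
Proof. by move=> f u v; apply: sectionP => x; exact: scalerDr. Qed.
Fact secZDl u : {morph secZ^~ u : f g / f + g}.
Proof. by move=> f g; apply: sectionP => x; exact: scalerDl. Qed.

HB.instance Definition _ := GRing.Zmodule_isLmodule.Build (smooth_fun M) (section E)
  secZA sec1Z secZDr secZDl.

End Operations.

End Bundle.

Arguments tcoord {R n M E} t x.
Arguments tinv {R n M E} t x _.
Arguments tframe {R n M E} t a x.
Arguments btriv {R n M} v _.

Section DualBundle.
Variables (R : realType) (n : nat) (M : manifold R n) (E : vbundle M).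

Definition dual_fibre (x : M) : lmodType R := dual (E x).

Section DualTriv.
Variable t : trivialization E.

Definition dual_coord_fun (x : M) (w : dual_fibre x) : 'rV[R]_(trank t) :=
  \row_a w (tframe t a x).

Fact dual_coord_linear x : linear (@dual_coord_fun x).
Proof. by move=> a u v; apply/rowP => i; rewrite !mxE. Qed.

HB.instance Definition _ x := GRing.isLinear.Build R (dual_fibre x) 'rV[R]_(trank t)
  *:%R (@dual_coord_fun x) (@dual_coord_linear x).

Definition dual_coord (x : M) : {linear dual_fibre x -> 'rV[R]_(trank t)} :=
  @dual_coord_fun x.

Fact dual_inv_linear (x : M) (c : 'rV[R]_(trank t)) :
  linear (fun e : E x => \sum_a c 0 a * tcoord t x e 0 a : R^o).
Proof.
move=> a u v; rewrite /GRing.scale /= mulr_sumr -big_split /=.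
by apply: eq_bigr => i _; rewrite linearP !mxE mulrDr mulrCA.
Qed.

Definition dual_inv (x : M) (c : 'rV[R]_(trank t)) : dual_fibre x :=
  mk_dual (dual_inv_linear c).

Lemma dual_expand x (w : dual_fibre x) (e : E x) : tdom t x ->
  w e = \sum_a w (tframe t a x) * tcoord t x e 0 a.
Proof.
move=> tx; rewrite {1}(tframe_expand e tx).
pose w' := GRing.isLinear.Build R (E x) R^o *:%R w (@dualP _ _ w).
pose wl : {linear E x -> R^o} := HB.pack (w : E x -> R^o) w'.
rewrite -[LHS]/(wl _) linear_sum; apply: eq_bigr => a _.
by rewrite linearZ /= mulrC.
Qed.

Fact dual_coordK x : tdom t x -> cancel (dual_coord x) (@dual_inv x).
Proof.
move=> tx w; apply: val_inj; apply/funext => e /=.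
by rewrite (dual_expand w e tx); apply: eq_bigr => a _; rewrite mxE.
Qed.

Fact dual_invK x : tdom t x -> cancel (@dual_inv x) (dual_coord x).
Proof.
move=> tx c; apply/rowP => b; rewrite mxE /=.
rewrite (bigD1 b) //= big1 => [|a ab].
  by rewrite tinvK // mxE !eqxx mulr1 addr0.
by rewrite tinvK // mxE (negbTE ab) andbF mulr0.
Qed.

Definition dual_triv : trivialization dual_fibre :=
  Trivialization (tdom_open t) dual_coordK dual_invK.

End DualTriv.

Definition dual_btriv : set (trivialization dual_fibre) := dual_triv @` btriv E.

Fact dual_btriv_cover x : exists2 t, dual_btriv t & tdom t x.
Proof.
have [t ht tx] := btriv_cover E x.
by exists (dual_triv t) => //; exists t.
Qed.

Fact dual_btriv_smooth s t : dual_btriv s -> dual_btriv t -> forall a b,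
  smooth_on (tdom s `&` tdom t) (fun x => tcoord t x (tframe s a x) 0 b).
Proof.
move=> [s' hs <-] [t' ht <-] /= a b.
have := btriv_smooth ht hs b a; rewrite setIC; apply: smooth_on_ext.
  by apply: openI; exact: tdom_open.
move=> x _; rewrite mxE /= (bigD1 a) //= big1 => [|i ia].
  by rewrite mxE !eqxx mul1r addr0.
by rewrite mxE (negbTE ia) andbF mul0r.
Qed.

Definition dual_bundle : vbundle M := VBundle dual_btriv_cover dual_btriv_smooth.

End DualBundle.

Notation one_form E := (section (dual_bundle E)).

Section Anchored.
Variables (R : realType) (n : nat) (M : manifold R n) (E : vbundle M).

(* A vector bundle morphism from [E] to the tangent bundle: it maps the local
   frames given by trivializations to smooth vector fields [X], i.e., such that
   [X f] is smooth for every locally defined smooth [f]. *)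
Record anchor := Anchor {
  anchor_val :> forall x, {linear E x -> tangent x} ;
  anchor_smooth : forall t, btriv E t -> forall a (U : set M) (f : M -> R),
    open U -> smooth_on U f ->
    smooth_on (U `&` tdom t) (fun x => anchor_val x (tframe t a x) f) }.

Variable rho : anchor.

(* [rho(u)(f)], also for functions [f] that are only smooth on an open set. *)
Definition anchor_act (u : section E) (f : M -> R) : M -> R :=
  fun x => rho x (u x) f.

Fact differential_linear (f : M -> R) (x : M) :
  linear (fun e : E x => rho x e f : R^o).
Proof. by move=> a u v; rewrite linearP. Qed.

(* [(D f)_x], also for functions [f] that are only smooth near [x]. *)
Definition differential_at (f : M -> R) (x : M) : dual_bundle E x :=
  mk_dual (differential_linear f (x := x)).

Fact differential_smooth (f : smooth_fun M) :
  smooth_section (differential_at f).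
Proof.
move=> _ [t ht <-] /= a.
have := anchor_smooth rho ht a openT (smooth_funP f); rewrite setTI.
by apply: smooth_on_ext; [exact: tdom_open|move=> x _; rewrite mxE].
Qed.

Definition differential (f : smooth_fun M) : one_form E :=
  Section_ (differential_smooth f).

Lemma pairing_smooth (w : one_form E) (u : section E) :
  smooth_on setT (fun x => w x (u x)).
Proof.
apply: smooth_on_local => x _; have [t ht tx] := btriv_cover E x.
have ot := tdom_open t; exists (tdom t); split => //.
apply: (@smooth_on_ext _ _ _ _ (fun x => \sum_a
    tcoord (dual_triv t) x (w x) 0 a * tcoord t x (u x) 0 a)) => //.
  move=> y ty; rewrite [RHS](dual_expand _ _ ty); apply: eq_bigr => a _.
  by rewrite mxE.
apply: smooth_on_sum => // a; apply: smooth_onM => //; last exact: sec_smooth.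
have ht' : btriv (dual_bundle E) (dual_triv t) by exists t.
exact: (sec_smooth w ht' a).
Qed.

Definition anchor_fun (u : section E) (f : smooth_fun M) : smooth_fun M :=
  mk_smooth_fun (pairing_smooth (differential f) u).

(* The image of [rho x] has dimension [k]. *)
Definition anchor_rank (x : M) (k : nat) :=
  exists b : 'I_k -> tangent x,
    [/\ forall i, range (rho x) (b i),
        forall c : 'I_k -> R, \sum_i c i *: b i = 0 -> forall i, c i = 0 &
        forall v, range (rho x) v -> exists c : 'I_k -> R, v = \sum_i c i *: b i].

Definition regular :=
  forall x : M, exists k, \forall y \near x, anchor_rank y k.

Definition in_kernel (u : section E) := forall x, rho x (u x) = 0.

Definition is_lie_bracket (X Y Z : forall x : M, tangent x) :=
  forall (x : M) (f : M -> R), smooth_near x f ->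
    Z x f = X x (fun y => Y y f) - Y x (fun y => X y f).

Definition Rbilinear (b : section E -> section E -> section E) :=
  (forall v (a : R) u u', b (cst_fun M a *: u + u') v =
     cst_fun M a *: b u v + b u' v) /\
  (forall u (a : R) v v', b u (cst_fun M a *: v + v') =
     cst_fun M a *: b u v + b u v').

Definition is_connection (nabla : section E -> section E -> section E) :=
  [/\ Rbilinear nabla,
      forall u f v, nabla u (f *: v) = anchor_fun u f *: v + f *: nabla u v &
      forall f u v, nabla (f *: u) v = f *: nabla u v].

Section Algebroid.
Variables (br : section E -> section E -> section E).
Variables (L : one_form E -> section E -> section E -> section E).

Definition local_almost_leibniz :=
  [/\ [/\ Rbilinear br,
      forall u v, linear (fun w => L w u v),
      forall w v, linear (fun u => L w u v) &
      forall w u, linear (fun v => L w u v)],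
      forall u f v, br u (f *: v) = anchor_fun u f *: v + f *: br u v &
      forall f u v, br (f *: u) v =
        - (anchor_fun v f *: u) + f *: br u v + L (differential f) u v].

Definition local_pre_leibniz :=
  local_almost_leibniz /\
  forall u v : section E, is_lie_bracket
    (fun x => rho x (u x)) (fun x => rho x (v x)) (fun x => rho x (br u v x)).

Variable P : {linear section E -> section E}.

Definition Lhat (w : one_form E) (u v : section E) : section E := P (L w u v).

Definition is_locality_projector :=
  (forall w u v, in_kernel (Lhat w u v)) /\
  (forall u, in_kernel u -> P u = u).

Variable nabla : section E -> section E -> section E.

(* [X_a] restricts to a frame of [E] near [x], with dual coframe [e^a]. *)
Definition local_frame (x : M) (r : nat) (X : 'I_r -> section E)
    (e : 'I_r -> one_form E) :=
  \forall y \near x,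
    (forall a b, e a y (X b y) = (a == b)%:R) /\
    (forall v : E y, v = \sum_a e a y v *: X a y).

(* [b] is the projected modified bracket of [u] and [v].  Since [nabla] and [L]
   act on global sections, the local frames are given by global sections: every
   local frame coincides near each point with global sections, by means of a bump
   function.  As [L], [P] and [nabla] (in its first argument) are
   C^infinity-linear, the values near [x] do not depend on the frame, so that
   there is exactly one such [b]. *)
Definition is_projected_bracket (u v b : section E) :=
  forall x, exists (r : nat) (X : 'I_r -> section E) (e : 'I_r -> one_form E),
    local_frame x X e /\
    \forall y \near x,
      b y = (br u v - \sum_a Lhat (e a) (nabla (X a) u) v) y.

Variable brhat : section E -> section E -> section E.

Definition projected_torsion (u v : section E) : section E :=
  nabla u v - nabla v u - brhat u v.

Definition projected_torsion_free := forall u v, projected_torsion u v = 0.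

Definition curvature (u v w : section E) : section E :=
  nabla u (nabla v w) - nabla v (nabla u w) - nabla (brhat u v) w.

Definition flat := forall u v w, curvature u v w = 0.

End Algebroid.

Record emetric := EMetric {
  emetric_val :> forall x, E x -> E x -> R ;
  emetric_linear : forall x (e : E x), linear (fun e' => emetric_val e' e : R^o) ;
  emetric_sym : forall x (e e' : E x), emetric_val e e' = emetric_val e' e ;
  emetric_nondegenerate : forall x (e : E x),
    (forall e', emetric_val e e' = 0) -> e = 0 ;
  emetric_smooth : forall t, btriv E t -> forall a b,
    smooth_on (tdom t) (fun x => emetric_val (tframe t a x) (tframe t b x)) }.

Variable nabla : section E -> section E -> section E.

Definition hessian (f : M -> R) (u v : section E) : M -> R := fun x =>
  anchor_act u (anchor_act v f) x - differential_at f x (nabla u v x).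

Definition emetric_fun (g : emetric) (u v : section E) : M -> R :=
  fun x => g x (u x) (v x).

Definition nonmetricity (g : emetric) (u v w : section E) : M -> R := fun x =>
  anchor_act u (emetric_fun g v w) x
  - emetric_fun g (nabla u v) w x - emetric_fun g v (nabla u w) x.

(* [u], [v] may be taken global: both sides depend only on their values at [y]. *)
Definition locally_hessian (g : emetric) :=
  forall x : M, exists (U : set M) (f : M -> R),
    [/\ open U, U x, smooth_on U f &
        forall u v y, U y -> emetric_fun g u v y = hessian f u v y].

Definition hessian_structure (brhat : section E -> section E -> section E)
    (g : emetric) :=
  [/\ is_connection nabla, flat nabla brhat,
      projected_torsion_free nabla brhat & locally_hessian g].

End Anchored.

Definition totally_symmetric (S T : Type) (Q : S -> S -> S -> T) :=
  forall u v w, Q u v w = Q v u w /\ Q u v w = Q u w v.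

(* Main.v *)
Require Import Defs.
From HB Require Import structures.
From mathcomp Require Import all_boot all_order all_algebra.
From mathcomp Require Import all_classical all_reals all_analysis.
From mathcomp Require Import lra.
Set Implicit Arguments.
Unset Strict Implicit.
Unset Printing Implicit Defensive.
Import Order.TTheory GRing.Theory Num.Theory numFieldNormedType.Exports.
Local Open Scope classical_set_scope.
Local Open Scope ring_scope.

(** Where [g = H(f)], expand [Q(u,v,w) - Q(v,u,w)] and write [u.f] for
    [rho(u)(f)].  The third-order terms leave [[rho u, rho v](w.f)], which is
    [[u,v].(w.f)] because [rho] is bracket-preserving; as [Lhat] takes values in
    the kernel of [rho], this is also [brhat(u,v).(w.f)], and it cancels against
    the term [(nabla_u v - nabla_v u).(w.f)] since the projected torsion vanishes.
    What remains is [- (R(u,v)w).f = 0].  Symmetry in the last two arguments is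
    the symmetry of [g]. *)

Section AnchorAction.
Variables (R : realType) (n : nat) (M : manifold R n) (E : vbundle M).
Variable rho : anchor E.
Implicit Types (u v w : section E) (f : M -> R) (U : set M).

Lemma tangentP (x : M) (v : tangent x) : @derivation_at R n M x v.
Proof. by case: v => v /= /asboolP. Qed.

(** Smoothness of both functions matters: a tangent vector takes the default value 0 off the
    functions smooth near [x], so it is linear only on smooth germs. *)
Lemma tangentB (x : M) (v : tangent x) (f h : M -> R) :
  smooth_near x f -> smooth_near x h ->
  v (fun y => f y - h y) = v f - v h.
Proof.
move=> sf sh; have [_ _ lin _] := tangentP v.
have -> : (fun y => f y - h y) = (fun y => -1 * h y + f y).
  by apply/funext => y; rewrite mulN1r addrC.
by rewrite lin // mulN1r addrC.
Qed.

(** Smoothness of an anchor is only given on local frames, so [u] is expanded in the frame of a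
    trivialization. *)
Lemma anchor_act_smooth U u f : open U -> smooth_on U f ->
  smooth_on U (anchor_act rho u f).
Proof.
move=> oU sf; apply: smooth_on_local => x Ux.
have [t ht tx] := btriv_cover E x; have ot := tdom_open t.
have oUt : open (U `&` tdom t) by exact: openI.
exists (U `&` tdom t); split=> //.
apply: (@smooth_on_ext _ _ _ _ (fun x => \sum_a
    tcoord t x (u x) 0 a * rho x (tframe t a x) f)) => //.
  move=> y [_ ty]; rewrite /anchor_act [in RHS](tframe_expand (u y) ty).
  rewrite (linear_sum (rho y)).
  (* Induction on the sum moves the evaluation at [f] inside a sum of tangent vectors. *)
  elim/big_rec2: _ => // a p q _ ->.
  by rewrite linearZ.
apply: smooth_on_sum => // a; apply: smooth_onM => //.
  by apply: smooth_on_sub (sec_smooth u ht a) => y [].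
exact: anchor_smooth.
Qed.

Lemma anchor_actBl u v f x :
  anchor_act rho (u - v) f x = anchor_act rho u f x - anchor_act rho v f x.
Proof. by rewrite /anchor_act [X in rho x X]/= linearB. Qed.

Lemma in_kernel0 : in_kernel rho 0.
Proof. by move=> x; rewrite /= linear0. Qed.

Lemma in_kernelD u v : in_kernel rho u -> in_kernel rho v -> in_kernel rho (u + v).
Proof. by move=> ku kv x; rewrite /= linearD ku kv addr0. Qed.

(** At [x], the two brackets differ by a finite sum of values of [Lhat], each killed by [rho]. *)
Lemma anchor_projected_bracket br L (P : {linear section E -> section E})
    nabla u v b x :
  (forall e u v, in_kernel rho (Lhat L P e u v)) ->
  is_projected_bracket br L P nabla u v b -> rho x (b x) = rho x (br u v x).
Proof.
move=> kerL /(_ x) [r [X [e [_ /nbhs_singleton ->]]]].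
rewrite /= linearB /=.
suff -> : rho x ((\sum_a Lhat L P (e a) (nabla (X a) u) v : section E) x) = 0.
  by rewrite subr0.
suff : in_kernel rho (\sum_a Lhat L P (e a) (nabla (X a) u) v) by exact.
by apply: big_ind => //; [exact: in_kernel0|exact: in_kernelD].
Qed.

Lemma emetric_funC (g : emetric E) u v : emetric_fun g u v = emetric_fun g v u.
Proof. by apply/funext => x; exact: emetric_sym. Qed.

Lemma nonmetricity_symr nabla (g : emetric E) u v w :
  nonmetricity rho nabla g u v w = nonmetricity rho nabla g u w v.
Proof.
apply/funext => x; rewrite /nonmetricity (emetric_funC g v w).
by rewrite (emetric_funC g _ w) (emetric_funC g v) addrAC.
Qed.

Lemma nonmetricity_hessian nabla (g : emetric E) U f u v w x :
  open U -> U x -> smooth_on U f ->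
  (forall u v y, U y -> emetric_fun g u v y = hessian rho nabla f u v y) ->
  let A := anchor_act rho in
  nonmetricity rho nabla g u v w x =
    A u (A v (A w f)) x - A u (A (nabla v w) f) x
    - (A (nabla u v) (A w f) x - A (nabla (nabla u v) w) f x)
    - (A v (A (nabla u w) f) x - A (nabla v (nabla u w)) f x).
Proof.
move=> oU Ux sf gE A; rewrite /nonmetricity !gE //; congr (_ - _ - _).
have smA s h : smooth_on U h -> smooth_near x (A s h).
  by move=> sh; exists U; split=> //; exact: anchor_act_smooth.
rewrite /anchor_act; have [_ germ _ _] := tangentP (rho x (u x)).
(* Here [g] is differentiated, so its Hessian form is needed on a whole neighbourhood of [x], not
   just at [x]. *)
rewrite (germ _ (fun y => A v (A w f) y - A (nabla v w) f y)).
  by rewrite tangentB //; apply: smA => //; exact: anchor_act_smooth.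
apply: filterS (open_nbhs_nbhs (conj oU Ux)) => y Uy.
by rewrite gE.
Qed.

End AnchorAction.

Theorem proposition6p2 (R : realType) (n : nat) (M : manifold R n)
    (hM : hausdorff_space M) (pM : paracompact M) (oM : orientable M)
    (E : vbundle M) (rho : anchor E) (hreg : regular rho)
    (br : section E -> section E -> section E)
    (L : one_form E -> section E -> section E -> section E)
    (hE : local_pre_leibniz rho br L)
    (P : {linear section E -> section E})
    (hP : is_locality_projector rho L P)
    (nabla : section E -> section E -> section E)
    (brhat : section E -> section E -> section E)
    (hbrhat : forall u v, is_projected_bracket br L P nabla u v (brhat u v))
    (g : emetric E) (hH : hessian_structure rho nabla brhat g) :
  totally_symmetric (nonmetricity rho nabla g).
Proof.
have [_ morph] := hE; have [kerL _] := hP.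
have [[[bilD _] _ _] fl tf locH] := hH.
suff sym12 u v w : nonmetricity rho nabla g u v w = nonmetricity rho nabla g v u w.
  by move=> u v w; split; [exact: sym12|exact: nonmetricity_symr].
apply/funext => x; have [U [f [oU Ux sf gE]]] := locH x.
rewrite !(nonmetricity_hessian _ _ _ oU Ux sf gE).
pose A := anchor_act rho.
have nablaBl p q : nabla (p - q) w = nabla p w - nabla q w.
  have := bilD w (-1) q p.
  have -> : cst_fun M (-1) = -1 by apply: val_inj; apply/funext.
  by rewrite !scaleN1r addrC => ->; rewrite addrC.
have torsion : brhat u v = nabla u v - nabla v u.
  by apply/esym/eqP; rewrite -subr_eq0; apply/eqP; exact: tf.
have bracket : A u (A v (A w f)) x - A v (A u (A w f)) x =
    A (nabla u v) (A w f) x - A (nabla v u) (A w f) x.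
  rewrite -anchor_actBl -torsion {3}/A /anchor_act.
  rewrite (anchor_projected_bracket x kerL (hbrhat u v)).
  rewrite (morph u v x) //.
  by exists U; split=> //; exact: anchor_act_smooth.
have curv : A (nabla u (nabla v w)) f x - A (nabla v (nabla u w)) f x =
    A (nabla (nabla u v) w) f x - A (nabla (nabla v u) w) f x.
  (* Both sides become the action on [f] of one section; these two sections differ by the curvature
     applied to [u], [v], [w]. *)
  rewrite -!anchor_actBl -nablaBl -torsion.
  by congr (A _ f x); apply/eqP; rewrite -subr_eq0; apply/eqP; exact: fl.
(* The mixed terms [A u (A (nabla v w) f) x] and [A v (A (nabla u w) f) x] occur with the same sign
   on both sides and cancel. *)
move: bracket curv; rewrite /A; lra.
Qed.
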